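(* Let $n$ be a natural number, let $p(\lambda)\in\mathbb{Q}[\lambda]$ be any polynomial, and let $A\in M_n(\mathbb{Q})$ have characteristic polynomial $f(\lambda)$ (of degree $n$) which is irreducible over $\mathbb{Q}$. Then the following are equivalent: (i) the equation $p(X)=A$ has a solution $X\in M_n(\mathbb{Q})$; (ii) the polynomial $f(p(\lambda))$ has a factor $h(\lambda)\in\mathbb{Q}[\lambda]$ of degree $n$; (iii) there exist an eigenvalue $\mu\in\sigma(A)$ and an element $\gamma\in\mathbb{Q}(\mu)$ such that $p(\gamma)=\mu$.
   Context: $M_n(\mathbb{Q})$ is the set of $n\times n$ matrices with rational entries. $\sigma(A)$ is the set of eigenvalues of $A$ in a fixed algebraic closure $\overline{\mathbb{Q}}$ of $\mathbb{Q}$, that is, the set of roots of $f(\lambda)$ in $\overline{\mathbb{Q}}$. For $\mu\in\overline{\mathbb{Q}}$, $\mathbb{Q}(\mu)\subset\overline{\mathbb{Q}}$ is the field generated by $\mu$ over $\mathbb{Q}$. A factor of a polynomial over $\mathbb{Q}$ is a polynomial in $\mathbb{Q}[\lambda]$ dividing it in $\mathbb{Q}[\lambda]$. *)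

(* Defs.v *)
From mathcomp Require Import all_boot all_order all_algebra all_field.

Set Implicit Arguments.
Unset Strict Implicit.
Unset Printing Implicit Defensive.

Import GRing.Theory.
Local Open Scope ring_scope.

(* [Qadjoin mu] is the field Q(mu) generated by mu over Q inside algC, i.e. the *)
(* least subset of algC that contains Q and mu and is closed under subtraction  *)
(* and division. Since x / 0 = 0 in algC, division needs no side condition.     *)
Inductive Qadjoin (mu : algC) : algC -> Prop :=
| Qadjoin_rat (q : rat) : Qadjoin mu (ratr q)
| Qadjoin_gen : Qadjoin mu mu
| Qadjoin_sub x y : Qadjoin mu x -> Qadjoin mu y -> Qadjoin mu (x - y)
| Qadjoin_div x y : Qadjoin mu x -> Qadjoin mu y -> Qadjoin mu (x / y).

(* Main.v *)
Require Import Defs.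
From HB Require Import structures.
From mathcomp Require Import all_boot all_order all_algebra all_field.

Set Implicit Arguments.
Unset Strict Implicit.
Unset Printing Implicit Defensive.

Import GRing.Theory.
Local Open Scope ring_scope.

(* If f is irreducible and a nonconstant h divides f(p), then a Bezout relation *)
(* composed with p shows that q |-> q(p) mod h is injective on polynomials of   *)
(* degree < deg f. Hence deg f <= deg h; with h the minimal polynomial of X     *)
(* this gives (i) -> (ii). If deg h = deg f the map is also surjective, so      *)
(* r(p) = 'X mod h for some r: a root gamma of h satisfies gamma = r(p(gamma)), *)
(* and mu = p(gamma) is an eigenvalue. Conversely gamma = r(mu) and p(gamma) =  *)
(* mu mean that f divides p(r) - 'X, whence p(r(A)) = A by Cayley-Hamilton.     *)

(** When [h] divides [f \Po p], substituting [p] induces a ring map from [F[x]/(f)] to [F[x]/(h)].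
    The source is a field, so the map is injective ([irreducible_dvd_comp]). Comparing dimensions
    gives [leq_size_irreducible_comp], and equal degrees make the map onto ([comp_modp_surj]).
    Condition (iii) is linked to polynomials by [Qadjoin_poly] and [poly_Qadjoin]: the elements of
    Q(mu) are the values at [mu] of rational polynomials. *)

Lemma horner_mx_comp (R : comNzRingType) (n : nat) (X : 'M[R]_n.+1)
    (p q : {poly R}) :
  horner_mx X (q \Po p) = horner_mx (horner_mx X p) q.
Proof.
elim/poly_ind: q => [|q c IHq]; first by rewrite comp_poly0 !rmorph0.
by rewrite comp_polyD comp_polyM comp_polyX comp_polyC !rmorphD !rmorphM /= IHq
           horner_mx_X !horner_mx_C.
Qed.

Section CompositionModuloAFactor.

Variables (F : fieldType) (f p h : {poly F}).
Hypotheses (irr_f : irreducible_poly f) (h_nonunit : ~~ (h %| 1)).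
Hypothesis h_dvd : h %| f \Po p.

(** Otherwise [u * f + v * q = 1] for some [u], [v]; after composition with [p], [h] divides both
    terms on the left, hence divides 1. *)
Lemma irreducible_dvd_comp (q : {poly F}) : h %| q \Po p -> f %| q.
Proof.
move=> hq; apply: contraNT h_nonunit; rewrite -(irreducible_poly_coprime _ irr_f).
case/Bezout_eq1_coprimepP=> -[u v] /= /(congr1 (comp_poly p)).
rewrite comp_polyD !comp_polyM (comp_polyC 1) polyC1 => <-.
by rewrite dvdp_add ?dvdp_mull.
Qed.

Lemma comp_modp_linear (m d : nat) :
  linear (fun v : 'rV[F]_m => poly_rV ((rVpoly v \Po p) %% h) : 'rV[F]_d).
Proof.
by move=> a u v; rewrite linearP comp_polyD comp_polyZ modpD modpZl linearP.
Qed.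

(** Composition with [p] modulo [h] as a matrix on coefficient vectors, so that injectivity and
    surjectivity become statements about rank. The width [d] is left free so that the matrix can be
    literally square when the degrees agree. *)
Definition comp_modp_mx (m d : nat) : 'M[F]_(m, d) :=
  \matrix_i poly_rV ((rVpoly (delta_mx 0 i : 'rV_m) \Po p) %% h).

Lemma mul_comp_modp_mx (m d : nat) (v : 'rV[F]_m) :
  v *m comp_modp_mx m d = poly_rV ((rVpoly v \Po p) %% h).
Proof.
pose L : {linear 'rV[F]_m -> 'rV[F]_d} :=
  HB.pack (fun v : 'rV[F]_m => poly_rV ((rVpoly v \Po p) %% h) : 'rV[F]_d)
    (GRing.isLinear.Build _ _ _ _ _ (@comp_modp_linear m d)).
rewrite -[RHS]/(L v) -mul_rV_lin1; congr (_ *m _).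
by apply/row_matrixP => i; rewrite rowK rowE mul_rV_lin1.
Qed.

Lemma comp_modp_mx_free (d : nat) :
  h != 0 -> (size h <= d.+1)%N -> row_free (comp_modp_mx (size f).-1 d).
Proof.
move=> h0 le_hd; apply: inj_row_free => v.
rewrite mul_comp_modp_mx => /(congr1 rVpoly).
rewrite linear0 poly_rV_K; last by rewrite -ltnS (leq_trans _ le_hd) ?ltn_modp.
move/eqP/irreducible_dvd_comp => f_dvd.
apply/eqP/contraT => v0.
have rv0 : rVpoly v != 0.
  by apply: contraNneq v0 => rv; rewrite -[v]rVpolyK rv linear0.
have := leq_trans (dvdp_leq rv0 f_dvd) (size_poly _ _).
(* A nonzero multiple of [f] cannot have size at most [(size f).-1], as [size f] is positive. *)
by case: irr_f; case: (size f) => //= k _ _; rewrite ltnn.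
Qed.

Lemma leq_size_irreducible_comp : h != 0 -> (size f <= size h)%N.
Proof.
move=> h0; have := @comp_modp_mx_free (size h).-1 h0 (leqSpred _).
rewrite /row_free => /eqP rk.
have := rank_leq_col (comp_modp_mx (size f).-1 (size h).-1).
by rewrite rk -size_poly_gt0 in h0 *; case: (size h) h0; case: (size f).
Qed.

Lemma comp_modp_surj (q : {poly F}) :
  size h = size f -> exists r : {poly F}, h %| r \Po p - q.
Proof.
move=> eq_hf; have f1 : (1 < size f)%N by case: irr_f.
have h0 : h != 0 by rewrite -size_poly_gt0 eq_hf ltnW.
have szf : size h = (size f).-1.+1 by rewrite eq_hf prednK // ltnW.
have := comp_modp_mx_free h0 (eq_leq szf).
rewrite row_free_unit => B_unit; set B := comp_modp_mx _ _ in B_unit.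
(* Equal degrees make the injective matrix square, hence invertible; [v] is the preimage of [q]
   modulo [h]. *)
pose v := poly_rV (q %% h) *m invmx B; exists (rVpoly v).
have := mul_comp_modp_mx (size f).-1 v; rewrite mulmxKV // => /(congr1 rVpoly).
rewrite !poly_rV_K; try by rewrite -ltnS -szf ltn_modp.
by move=> eq_mod; rewrite /dvdp modpD modpN eq_mod subrr.
Qed.

End CompositionModuloAFactor.

Section RationalRoots.

Variables (f : {poly rat}) (mu : algC).
Hypotheses (irr_f : irreducible_poly f) (f_mu : root (map_poly ratr f) mu).

(** Coprimality over the rationals persists over [algC], where it excludes the common root [mu]. *)
Lemma irreducible_root_dvd (q : {poly rat}) :
  root (map_poly ratr q) mu -> f %| q.
Proof.
move=> q_mu; apply/contraT; rewrite -(irreducible_poly_coprime _ irr_f).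
rewrite -(coprimep_map (ratr : {rmorphism rat -> algC})) => /coprimep_root.
by move=> /(_ _ f_mu); rewrite (rootP q_mu) eqxx.
Qed.

Lemma Qadjoin_poly (x : algC) :
  Qadjoin mu x -> exists r : {poly rat}, (map_poly ratr r).[mu] = x.
Proof.
elim=> [q| |y z _ [r <-] _ [s <-]|y z _ [r <-] _ [s <-]].
- by exists q%:P; rewrite map_polyC hornerC.
- by exists 'X; rewrite map_polyX hornerX.
- by exists (r - s); rewrite rmorphB hornerD hornerN.
have [s_mu | s_mu] := boolP (root (map_poly ratr s) mu).
  (* The divisor is zero, so the quotient is 0 by convention. *)
  by exists 0; rewrite (rootP s_mu) invr0 mulr0 rmorph0 horner0.
have : coprimep f s.
  rewrite irreducible_poly_coprime //; apply: contra s_mu => /dvdpP[t ->].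
  by rewrite rmorphM rootM f_mu orbT.
case/Bezout_eq1_coprimepP=> -[u v] /= /(congr1 (map_poly (ratr : rat -> algC))).
move=> /(congr1 (horner^~ mu)).
rewrite rmorphD !rmorphM /= rmorph1 hornerD !hornerM (rootP f_mu).
rewrite mulr0 add0r hornerC.
(* The Bezout relation evaluated at [mu] loses its [f] term, so [v] takes there the inverse of the
   value of [s]. *)
move=> vs1; exists (r * v); rewrite rmorphM hornerM; congr (_ * _).
by apply: (mulIf s_mu); rewrite vs1 mulVf.
Qed.

End RationalRoots.

Lemma poly_Qadjoin (mu : algC) (r : {poly rat}) :
  Qadjoin mu (map_poly ratr r).[mu].
Proof.
have Q0 : Qadjoin mu 0.
  by rewrite -(rmorph0 (ratr : {rmorphism rat -> algC})); apply: Qadjoin_rat.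
have Q1 : Qadjoin mu 1.
  by rewrite -(rmorph1 (ratr : {rmorphism rat -> algC})); apply: Qadjoin_rat.
(* Sums and products come from [x - (0 - y)] and [x / (1 / y)]; the latter also holds at [y = 0]. *)
have QD x y : Qadjoin mu x -> Qadjoin mu y -> Qadjoin mu (x + y).
  by move=> Qx Qy; rewrite -[y]opprK -[- y]sub0r; do 2?apply: Qadjoin_sub.
have QM x y : Qadjoin mu x -> Qadjoin mu y -> Qadjoin mu (x * y).
  by move=> Qx Qy; rewrite -[y]invrK -[y^-1]mul1r; do 2?apply: Qadjoin_div.
elim/poly_ind: r => [|r c IHr]; first by rewrite rmorph0 horner0.
rewrite rmorphD rmorphM /= map_polyX map_polyC hornerMXaddC.
by apply: QD; [apply: QM => //; apply: Qadjoin_gen | apply: Qadjoin_rat].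
Qed.

(* The matrix size is n.+1 >= 1, so "degree n.+1" reads "size = n.+2". *)
Theorem theorem4 (n : nat) (p : {poly rat}) (A : 'M[rat]_n.+1)
    (irr_f : irreducible_poly (char_poly A)) :
  [<-> exists X : 'M[rat]_n.+1, horner_mx X p = A;
       exists h : {poly rat}, size h = n.+2 /\ h %| char_poly A \Po p;
       exists mu : algC, eigenvalue (map_mx ratr A) mu /\
         exists gamma : algC,
           Qadjoin mu gamma /\ (map_poly ratr p).[gamma] = mu].
Proof.
have nonunit (h : {poly rat}) : (1 < size h)%N -> ~~ (h %| 1).
  by move=> h1; rewrite dvdp1 neq_ltn h1 orbT.
tfae.
- case=> X pX; exists (mxminpoly X).
  (* Evaluating [char_poly A \Po p] at [X] gives [char_poly A] at [A], which is 0. *)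
  have dvd_f : mxminpoly X %| char_poly A \Po p.
    by apply: mxminpoly_min; rewrite horner_mx_comp pX Cayley_Hamilton.
  split=> //; apply/eqP; rewrite eqn_leq; apply/andP; split.
    rewrite -(size_char_poly X) dvdp_leq ?mxminpoly_dvd_char //.
    by rewrite -size_poly_gt0 size_char_poly.
  rewrite -(size_char_poly A).
  apply: (leq_size_irreducible_comp irr_f _ dvd_f).
    by apply: nonunit; rewrite size_mxminpoly ltnS mxminpoly_nonconstant.
  exact/monic_neq0/mxminpoly_monic.
- case=> h [sz_h h_dvd].
  have [r r_dvd] : exists r : {poly rat}, h %| r \Po p - 'X.
    apply: (comp_modp_surj irr_f _ h_dvd); last by rewrite size_char_poly.
    by apply: nonunit; rewrite sz_h.
  have /closed_rootP[g h_g] : size (map_poly (ratr : rat -> algC) h) != 1%N.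
    by rewrite size_map_poly sz_h.
  have root_h (q : {poly rat}) : h %| q -> root (map_poly ratr q) g.
    by case/dvdpP=> t ->; rewrite rmorphM rootM h_g orbT.
  exists (map_poly ratr p).[g]; split.
    rewrite eigenvalue_root_char -map_char_poly.
    by move/root_h: h_dvd; rewrite map_comp_poly /root horner_comp.
  exists g; split=> //.
  move/root_h: r_dvd; rewrite rmorphB /= map_comp_poly map_polyX /root.
  (* Only the second [g] is rewritten, as the value of [r] at [mu]; the first one sits inside [mu]
     itself. *)
  rewrite hornerD hornerN hornerX horner_comp subr_eq0 => /eqP {2}<-.
  exact: poly_Qadjoin.
case=> mu [mu_eig [g [/Qadjoin_poly Qg p_g]]].
rewrite eigenvalue_root_char -map_char_poly in mu_eig.
have [r r_mu] := Qg _ irr_f mu_eig.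
exists (horner_mx A r); rewrite -horner_mx_comp; apply/eqP.
(* This polynomial vanishes at [mu], because [r] sends [mu] to [g] and [p] sends [g] back to
   [mu]. *)
have /dvdpP[t t_eq] : char_poly A %| p \Po r - 'X.
  apply: (irreducible_root_dvd irr_f mu_eig).
  rewrite rmorphB /= map_comp_poly map_polyX /root.
  by rewrite hornerD hornerN hornerX horner_comp r_mu p_g subrr.
rewrite -subr_eq0 -[X in _ - X]horner_mx_X -rmorphB t_eq rmorphM /=.
by rewrite Cayley_Hamilton mulr0.
Qed.
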